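(* Let $X$ be a Banach space such that its dual $X^*$ has Rademacher type $p\in(1,2]$ with constant $T_p(X^* )$. Let $k\ge 1$ be an integer and set $$r_k(X)=6\,T_p(X^* )\,k^{-1+\frac1p}.$$ Let $\mathcal{F}$ be a finite family of convex sets in $X$. Assume that for every choice of $k$ (not necessarily distinct) sets $K_1,\dots,K_k\in\mathcal{F}$ the intersection $\mathbf{B}_X\cap\bigcap_{i=1}^k K_i$ is non-empty. Then there exists a point $x\in X$ such that $$\operatorname{dist}(x,K)\le r_k(X)\qquad\text{for all }K\in\mathcal{F}.$$ In particular, every Banach space whose dual is of non-trivial type has the Helly approximation property.
   Context: $\mathbf{B}_X$ denotes the (closed) unit ball of the Banach space $X$, and $\operatorname{dist}(x,K)=\inf_{z\in K}\|x-z\|$. Rademacher type: a Banach space $Y$ is of (Rademacher) type $p$, for some $p\ge1$, if there is a constant $T$ such that for every finite set $S$ of vectors in $Y$, the average norm of the $2^{|S|}$ vectors of the form $\sum_{s\in S}\pm s$ does not exceed $T\left(\sum_{s\in S}\|s\|^p\right)^{1/p}$. The minimal such constant $T$ is denoted $T_p(Y)$. A space is of non-trivial type if its maximal type is strictly greater than one, i.e. it is of type $p$ for some $p>1$; otherwise it is of trivial type. The $R$-neighborhood of a set $A\subset X$ is $\{x\in X:\operatorname{dist}(x,A)\le R\}$. A sequence $\{r_k\}_{k\in\mathbb{N}}$ (with $\mathbb{N}=\{1,2,\dots\}$) is a Helly approximation sequence of $X$ if for every $k$ and every finite family $\mathcal{F}$ of convex subsets of $X$ the following holds: if any $k$ (not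 necessarily distinct) sets of $\mathcal{F}$ have a common point inside the unit ball $\mathbf{B}_X$, then the $r_k$-neighborhoods of all sets in $\mathcal{F}$ have a common point. $X$ has the Helly approximation property if it has a Helly approximation sequence with $r_k\to0$ as $k\to\infty$. *)

(* Defs.v *)
From HB Require Import structures.
From mathcomp Require Import all_boot all_order all_algebra finmap.
From mathcomp Require Import all_classical all_reals all_analysis.

Set Implicit Arguments.
Unset Strict Implicit.
Unset Printing Implicit Defensive.

Import Order.TTheory GRing.Theory Num.Theory.
Import numFieldNormedType.Exports.

Local Open Scope classical_set_scope.
Local Open Scope ring_scope.

Definition unit_ball (R : realType) (X : normedModType R) : set X :=
  [set x | `|x| <= 1].
Arguments unit_ball {R} X.

(* The library has no dual space: the topological dual X^* is built below as the
   type of continuous linear functionals with the operator norm, and shown to be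
   a Banach space. *)
Definition is_functional (R : realType) (X : normedModType R) :
  pred (X -> R^o) := fun f => `[< linear f /\ continuous f >].

Section dual.
Context (R : realType) (X : normedModType R).

Record dual := Dual {
  dual_fun :> X -> R^o ;
  dual_funP : is_functional dual_fun }.

HB.instance Definition _ := [isSub for dual_fun].
HB.instance Definition _ := [Choice of dual by <:].

Lemma is_functional_submod_closed : submod_closed (@is_functional R X).
Proof.
split.
  apply/asboolP; split; last exact: cst_continuous.
  move=> a x y; have -> : (0 : X -> R^o) (a *: x + y) = 0 by [].
  by rewrite [RHS](_ : _ = a *: (0 : R^o) + 0)// scaler0 addr0.
move=> a f g /asboolP[lf cf] /asboolP[lg cg]; apply/asboolP; split.
  move=> b x y.
  have E z : (a *: f + g) z = a * f z + g z :> R by [].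
  have Ef : f (b *: x + y) = b * f x + f y :> R := lf b x y.
  have Eg : g (b *: x + y) = b * g x + g y :> R := lg b x y.
  have H : (a *: f + g) (b *: x + y) = b * (a *: f + g) x + (a *: f + g) y :> R.
    by rewrite !E Ef Eg !mulrDr !mulrA (mulrC b a) addrACA.
  exact: H.
move=> x; apply: (@continuousD _ _ _ (fun x => a *: f x)); last exact: cg.
apply: (@continuousZ _ _ _ (fun=> a) f); first exact: cst_continuous.
exact: cf.
Qed.

HB.instance Definition _ := GRing.isSubmodClosed.Build _ _ (@is_functional R X)
  is_functional_submod_closed.
HB.instance Definition _ := [SubChoice_isSubLmodule of dual by <:].

Lemma dual_linear (f : dual) : linear f.
Proof. by have /asboolP[] := dual_funP f. Qed.

HB.instance Definition _ (f : dual) :=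
  GRing.isLinear.Build R X R^o *:%R f (dual_linear f).

Lemma dual_continuous (f : dual) : continuous f.
Proof. by have /asboolP[] := dual_funP f. Qed.

Definition opnorm (f : dual) : R := sup [set `|f x| | x in unit_ball X].

Let opnorm_has_ubound (f : dual) : has_ubound [set `|f x| | x in unit_ball X].
Proof.
have [r [r0 fr]] : exists r, 0 < r /\ forall x, `|f x| <= r * `|x|.
  have /linear_boundedP/pinfty_ex_gt0[r r0 fr] :=
    continuous_linear_bounded 0 (@dual_continuous f 0).
  by exists r.
exists r => _ [x x1 <-]; apply: (le_trans (fr x)).
by rewrite ler_piMr// ltW.
Qed.

Lemma opnorm_ge0 (f : dual) : 0 <= opnorm f.
Proof.
have := ub_le_sup (opnorm_has_ubound f); apply.
by exists 0; rewrite /unit_ball /= ?normr0// linear0 normr0.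
Qed.

Lemma dual_le (f : dual) (x : X) : `|f x| <= opnorm f * `|x|.
Proof.
have [->|x0] := eqVneq x 0; first by rewrite linear0 !normr0 mulr0.
have xp : 0 < `|x| by rewrite normr_gt0.
have : `|f (`|x|^-1 *: x)| <= opnorm f.
  apply: (ub_le_sup (opnorm_has_ubound f)); exists (`|x|^-1 *: x) => //.
  by rewrite /unit_ball /= normrZ normfV normr_id mulVf// gt_eqF.
by rewrite linearZ/= normrZ normfV normr_id mulrC ler_pdivrMr.
Qed.

Lemma opnorm_le (f : dual) (M : R) :
  0 <= M -> (forall x, `|f x| <= M * `|x|) -> opnorm f <= M.
Proof.
move=> M0 fM; apply: ge_sup.
  by exists `|f 0|; exists 0; rewrite // /unit_ball /= normr0.
by move=> _ [x x1 <-]; apply: (le_trans (fM x)); rewrite ler_piMr.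
Qed.

Lemma opnormD (f g : dual) : opnorm (f + g) <= opnorm f + opnorm g.
Proof.
apply: opnorm_le => [|x]; first by rewrite addr_ge0 ?opnorm_ge0.
rewrite [X in `|X|]/(f x + g x) mulrDl.
by apply: (le_trans (ler_normD _ _)); rewrite lerD ?dual_le.
Qed.

Let opnormZ_le (a : R) (f : dual) : opnorm (a *: f) <= `|a| * opnorm f.
Proof.
apply: opnorm_le => [|x]; first by rewrite mulr_ge0 ?opnorm_ge0.
by rewrite [X in `|X|]/(a *: f x) normrZ -mulrA ler_wpM2l ?dual_le.
Qed.

Lemma opnormZ (a : R) (f : dual) : opnorm (a *: f) = `|a| * opnorm f.
Proof.
apply/eqP; rewrite eq_le opnormZ_le/=.
have [->|a0] := eqVneq a 0; first by rewrite normr0 mul0r opnorm_ge0.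
rewrite -{1}[f](scalerK a0) -ler_pdivlMl ?normr_gt0//.
by rewrite -normfV opnormZ_le.
Qed.

Lemma opnorm_eq0 (f : dual) : opnorm f = 0 -> f = 0.
Proof.
move=> f0; apply/val_inj/funext => x; apply/eqP.
by rewrite -normr_le0 -[leRHS](mul0r `|x|) -f0 dual_le.
Qed.

HB.instance Definition _ :=
  Lmodule_isNormed.Build R dual opnormD opnormZ opnorm_eq0.

Lemma dual_normE (f : dual) : `|f| = sup [set `|f x| | x in unit_ball X].
Proof. by []. Qed.

Lemma dual_complete (F : set_system dual) :
  ProperFilter F -> cauchy F -> cvg F.
Proof.
move=> FF /cauchy_ballP Fc.
have Fnear (e : R) : 0 < e ->
    \forall f \near F, \forall h \near F,
      forall x, `|(f : dual) x - (h : dual) x| <= e * `|x|.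
  move=> e0; apply: filterS (nearP_dep (Fc e e0)) => f.
  apply: (@filterS _ F _) => h fh x.
  have -> : f x - h x = (f - h) x by [].
  apply: (le_trans (dual_le _ _)); rewrite ler_wpM2r//.
  by move: fh; rewrite -ball_normE /= => /ltW.
have ev_cvg x : cvg ((fun f : dual => f x) @ F).
  apply: cauchy_cvg; apply/cauchy_exP => e e0.
  have e0' : 0 < e / (`|x| + 1) by rewrite divr_gt0// ltr_wpDl.
  have [f fF] := filter_ex (Fnear _ e0'); exists (f x).
  rewrite nbhs_simpl /=; apply: filterS fF => h /(_ x) fh.
  rewrite -ball_normE /=; apply: (le_lt_trans fh); rewrite mulrAC ltr_pdivrMr ?ltr_wpDl//.
  by rewrite ltr_pM2l// ltrDl.
pose g (x : X) : R^o := lim ((fun f : dual => f x) @ F).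
have gE x : (fun f : dual => f x) @ F --> g x by exact: ev_cvg.
have gF (e : R) : 0 < e -> \forall f \near F, forall x, `|(f : dual) x - g x| <= e * `|x|.
  move=> e0; apply: filterS (Fnear e e0) => f fF x.
  have cfg : (fun h : dual => `|f x - h x|) @ F --> `|f x - g x|.
    by apply: cvg_norm; apply: cvgB; [exact: cvg_cst|exact: gE].
  rewrite -(cvg_lim _ cfg)//; apply: limr_le.
    by apply/cvg_ex; eexists; exact: cfg.
  by apply: filterS fF.
have lg : linear g.
  move=> a x y; apply: (cvg_unique _ (gE (a *: x + y))) => //.
  rewrite (_ : (fun f : dual => f (a *: x + y)) = fun f => a *: f x + f y).
    by apply: cvgD (gE y); apply: cvgZr; exact: gE.
  by apply/funext => f; rewrite dual_linear.
pose gl : {linear X -> R^o} := HB.pack g (GRing.isLinear.Build _ _ _ _ g lg).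
have cg : continuous g.
  have [f fg] := filter_ex (gF 1 ltr01).
  apply: (@bounded_linear_continuous _ _ _ gl); apply/linear_boundedP.
  apply: filterS (nbhs_pinfty_ge (num_real (1 + opnorm f))) => r fr x.
  rewrite -[gl x](subrK (f x)).
  apply: (le_trans (ler_normD _ _)); rewrite distrC.
  apply: (le_trans (lerD (fg x) (dual_le f x))).
  by rewrite -mulrDl ler_wpM2r.
have gP : is_functional g by apply/asboolP.
apply/cvg_ex; exists (Dual gP); apply/cvgrPdist_le => e e0.
apply: filterS (gF e e0) => f fg; rewrite distrC.
by apply: opnorm_le; rewrite ?ltW.
Qed.

HB.instance Definition _ := Uniform_isComplete.Build dual dual_complete.

End dual.
Arguments dual {R} X.

Section rademacher.
Context (R : realType) (Y : completeNormedModType R).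

(* The 2^|S| sign vectors indexed by their sets of minus signs. *)
Definition average_sign_norm (S : {fset Y}) : R :=
  (2 ^+ #|` S|)^-1 *
  \sum_(e : {ffun S -> bool}) `|\sum_(s : S) (-1) ^+ e s *: val s|.

(* [0 <= T] matters for [Y = 0] only: every real number would otherwise be
   admissible there, and there would be no minimal one. *)
Definition is_type_constant (p T : R) : Prop :=
  0 <= T /\
  forall S : {fset Y},
    average_sign_norm S <= T * (\sum_(s : S) `|val s| `^ p) `^ p^-1.

Definition rademacher_type (p : R) : Prop :=
  1 <= p /\ exists T, is_type_constant p T.

Definition type_constant (p : R) : R := inf [set T | is_type_constant p T].

Definition nontrivial_type : Prop := exists2 p : R, 1 < p & rademacher_type p.

End rademacher.

Section helly.
Context (R : realType) (X : completeNormedModType R).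

Definition dist (x : X) (K : set X) : \bar R :=
  ereal_inf [set `|x - z|%:E | z in K].

Definition neighborhood (r : R) (A : set X) : set X :=
  [set x | (dist x A <= r%:E)%E].

(* The chosen sets need not be distinct: [K] need not be injective. *)
Definition meets_in_ball (k : nat) (F : set (set X)) : Prop :=
  forall K : 'I_k -> set X, (forall i, F (K i)) ->
    unit_ball X `&` \bigcap_(i in [set: 'I_k]) K i !=set0.

(* Indices start at 1; [r 0] is irrelevant. *)
Definition helly_approximation_sequence (r : nat -> R) : Prop :=
  forall k : nat, (0 < k)%N ->
  forall F : set (set X), finite_set F -> (forall K, F K -> convex_set K) ->
    meets_in_ball k F ->
    \bigcap_(K in F) neighborhood (r k) K !=set0.

Definition helly_approximation_property : Prop :=
  exists2 r : nat -> R, helly_approximation_sequence r & r @ \oo --> (0 : R).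

End helly.

(* Main.v *)
Require Import Defs.
From HB Require Import structures.
From mathcomp Require Import all_boot all_order all_algebra finmap.
From mathcomp Require Import all_classical all_reals all_analysis.
From mathcomp Require Import lra.

(** Suppose that every point [x] is at distance more than [r] from some set of the
    family [K].  Separating the families [fun i => x - z i], with [z i] in [K i], from a
    ball in a finite power of [X] gives functionals [f i] with sum zero, total norm
    one, and bounds [h i] of [f i] on [K i] whose sum is at most [- r]
    ([far_convex_sets_certificate]).  The Hahn-Banach theorem behind it is
    [hahn_banach_cone], obtained from a minimal sublinear functional.

    The weights [`|f i|] form a probability, and Maurey's empirical method
    applies to it: draw [k] indices independently and add the normalized functionals
    [f i / `|f i|].  They are centered, so symmetrization
    ([iid_mean_norm_le_rademacher]) and the type of the dual ([type_unit_vectors])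
    bound the mean norm of their sum by [2 (T k ^ (1/p) + 1)].  The drawn sets have a
    common point in the unit ball; there the sum is at least minus its norm, and at most
    the sum of the [h i / `|f i|], whose mean is at most [- k r].  Hence
    [k r <= 2 (T k ^ (1/p) + 1)] ([far_family_radius_le]), and since [T k ^ (1/p)] is
    at least 1, [r <= 4 T k ^ (-1 + 1/p)].  The radius of the theorem has 6 in place
    of 4. *)

Import Order.TTheory GRing.Theory Num.Theory.
Import numFieldNormedType.Exports.
Local Open Scope classical_set_scope.
Local Open Scope ring_scope.

(** * Hahn-Banach for a cone of lower bounds *)

Section hahn_banach.
Context {R : realType} {V : lmodType R}.
Implicit Types (p q : V -> R) (D : V -> R -> Prop).

Definition sublinear q :=
  (forall x y, q (x + y) <= q x + q y) /\
  (forall t x, 0 <= t -> q (t *: x) <= t * q x).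

Lemma sublinear0 q : sublinear q -> q 0 = 0.
Proof.
move=> [qD qZ]; apply/eqP; rewrite eq_le; apply/andP; split.
  by have := qZ 0 0 (lexx 0); rewrite scaler0 mul0r.
by have := qD 0 0; rewrite addr0 lerDl.
Qed.

Lemma sublinear_scale q t x : sublinear q -> 0 <= t -> q (t *: x) = t * q x.
Proof.
move=> sq; rewrite le_eqVlt => /predU1P[<-|t0].
  by rewrite scale0r mul0r sublinear0.
apply/eqP; rewrite eq_le (sq.2 _ _ (ltW t0)) -ler_pdivlMl//=.
have := sq.2 t^-1 (t *: x); rewrite scalerA mulVf ?gt_eqF// scale1r.
by apply; rewrite invr_ge0 ltW.
Qed.

Lemma sublinear_lower q x : sublinear q -> - q (- x) <= q x.
Proof.
move=> sq; rewrite lerNl -subr_ge0 opprK addrC.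
by have := sq.1 x (- x); rewrite subrr sublinear0.
Qed.

(** A convex cone in [V * R], as a relation: [D c b] records the demand that a
    functional take a value at least [b] at [c]. *)
Definition subcone D :=
  [/\ D 0 0,
      forall c b c' b', D c b -> D c' b' -> D (c + c') (b + b') &
      forall t c b, 0 <= t -> D c b -> D (t *: c) (t * b)].

(** A sublinear [q] that meets the demands of a cone can be lowered to a
    sublinear [q'] below [fun y => q (y + c) - b].  At [y = - c] this reads
    [q' (- c) <= - b], so every linear functional below [q'] meets the demands.
    The infimum of these bounds is finite because [b <= q c] forces
    [q (y + c) - b >= - q (- y)], and subadditive because [D] is a cone. *)
Lemma sublinear_descend {q D} : sublinear q -> subcone D ->
    (forall c b, D c b -> b <= q c) ->
  exists2 q', sublinear q' &
    forall y c b, D c b -> q' y <= q (y + c) - b.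
Proof.
move=> sq [D0 DD DZ] Dq.
pose A y := [set v | exists c b, D c b /\ v = q (y + c) - b].
have A0 y : A y !=set0 by exists (q (y + 0) - 0), 0, 0.
have Alb y : has_lbound (A y).
  exists (- q (- y)) => _ [c [b [/Dq bc ->]]].
  rewrite lerBrDr addrC lerBlDr (le_trans bc)//.
  by have := sq.1 (y + c) (- y); rewrite addrAC subrr add0r.
have Ale y c b : D c b -> inf (A y) <= q (y + c) - b.
  by move=> Dc; apply: ge_inf => //; exists c, b.
exists (fun y => inf (A y)) => //; split=> [x y|t x].
  rewrite -lerBlDr; apply: lb_le_inf => // _ [c [b [Dcb ->]]].
  rewrite lerBlDl -lerBlDr; apply: lb_le_inf => // _ [c' [b' [Dcb' ->]]].
  rewrite lerBlDr; apply: (le_trans (Ale _ _ _ (DD _ _ _ _ Dcb' Dcb))).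
  rewrite opprD [leRHS]addrACA lerD2r (addrC x) [y + x + _]addrACA.
  exact: sq.1.
rewrite le_eqVlt => /predU1P[<-|t0].
  by rewrite scale0r mul0r; have := Ale 0 _ _ D0; rewrite !addr0 sublinear0// subrr.
rewrite -ler_pdivrMl//; apply: lb_le_inf => // _ [c [b [Dcb ->]]].
rewrite ler_pdivrMl// mulrBr -(sublinear_scale _ _ _ sq (ltW t0)) scalerDr.
by apply: Ale; apply: DZ => //; exact: ltW.
Qed.

(** Zorn's lemma: the pointwise infimum of a chain of sublinear functionals below
    [q] is again sublinear, and it is finite since each of them is bounded below by
    [fun x => - q (- x)]. *)
Lemma exists_minimal_sublinear q : sublinear q ->
  exists p, [/\ sublinear p, forall x, p x <= q x &
    forall p', sublinear p' -> (forall x, p' x <= p x) -> p' = p].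
Proof.
move=> sq.
pose T := {p : V -> R | sublinear p /\ forall x, p x <= q x}.
pose rT (p p' : T) := `[< forall x, sval p' x <= sval p x >].
have [|||A totA|[p [sp pq]] pmin] := @Zorn T rT.
- by move=> p; apply/asboolP.
- by move=> p1 p2 p3 /asboolP h1 /asboolP h2; apply/asboolP => x; exact: le_trans (h1 x).
- move=> [p1 h1] [p2 h2] /asboolP h12 /asboolP h21; apply: eq_exist.
  by apply/funext => x; apply/eqP; rewrite eq_le h12 h21.
- have [[p0 Ap0]|/forallNP A0] := pselect (A !=set0); last first.
    by exists (exist _ q (conj sq (fun x => lexx _))) => s /A0.
  pose B x := [set sval (p : T) x | p in A].
  have B0 x : B x !=set0 by exists (sval p0 x), p0.
  have Blb x : has_lbound (B x).
    exists (- q (- x)) => _ [[p [sp pq]] /= _ <-].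
    by rewrite (le_trans _ (sublinear_lower _ x sp))// lerN2.
  have Ble x (p : T) : A p -> inf (B x) <= sval p x.
    by move=> Ap; apply: ge_inf => //; exists p.
  have sB : sublinear (fun x => inf (B x)).
    split=> [x y|t x t0].
      rewrite -lerBlDr; apply: lb_le_inf => // _ [p Ap <-].
      rewrite lerBlDl -lerBlDr; apply: lb_le_inf => // _ [p' Ap' <-].
      rewrite lerBlDr.
      have [/asboolP h|/asboolP h] := totA _ _ Ap Ap'.
        apply: (le_trans (Ble _ _ Ap')); apply: (le_trans ((svalP p').1.1 _ _)).
        by rewrite addrC lerD2l.
      apply: (le_trans (Ble _ _ Ap)); apply: (le_trans ((svalP p).1.1 _ _)).
      by rewrite addrC lerD2r.
    have [->|tn0] := eqVneq t 0.
      rewrite scale0r mul0r; apply: (le_trans (Ble _ _ Ap0)).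
      by rewrite (sublinear0 _ (svalP p0).1).
    have tp : 0 < t by rewrite lt_neqAle eq_sym tn0.
    rewrite -ler_pdivrMl//; apply: lb_le_inf => // _ [p Ap <-].
    rewrite ler_pdivrMl// -(sublinear_scale _ _ _ (svalP p).1 t0).
    exact: Ble.
  have Bq x : inf (B x) <= q x.
    by apply: (le_trans (Ble _ _ Ap0)); exact: (svalP p0).2.
  exists (exist _ (fun x => inf (B x)) (conj sB Bq) : T) => p Ap.
  by apply/asboolP => x; exact: Ble.
- exists p; split=> // p' sp' p'p.
  have p'q x : p' x <= q x by exact: le_trans (p'p x) (pq x).
  have := pmin (exist _ p' (conj sp' p'q)).
  have -> : rT (exist _ p (conj sp pq)) (exist _ p' (conj sp' p'q)) by apply/asboolP.
  by move=> /(_ isT)[].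
Qed.

(** Lowering a minimal [p] along the ray through [(c, p c)] cannot change it, so
    [p y <= p (y + c) - p c]; together with subadditivity [p] is additive. *)
Lemma minimal_sublinear_linear p : sublinear p ->
    (forall p', sublinear p' -> (forall x, p' x <= p x) -> p' = p) ->
  linear (p : V -> R^o).
Proof.
move=> sp pmin.
have padd x c : p (x + c) = p x + p c.
  apply/eqP; rewrite eq_le sp.1 /=.
  pose D v b := exists2 t, 0 <= t & v = t *: c /\ b = t * p c.
  have cD : subcone D.
    split.
    - by exists 0 => //; rewrite scale0r mul0r.
    - move=> _ _ _ _ [t t0 [-> ->]] [s s0 [-> ->]].
      by exists (t + s); [exact: addr_ge0|rewrite scalerDl mulrDl].
    - move=> s _ _ s0 [t t0 [-> ->]].
      by exists (s * t); [exact: mulr_ge0|rewrite scalerA mulrA].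
  have Dp v b : D v b -> b <= p v.
    by move=> [t t0 [-> ->]]; rewrite sublinear_scale.
  have [p' sp' hp'] := sublinear_descend sp cD Dp.
  rewrite -lerBrDr.
  have E : p' = p.
    apply: pmin => // y; have [D0 _ _] := cD.
    by rewrite (le_trans (hp' y _ _ D0))// addr0 subr0.
  rewrite -{1}E; apply: hp'.
  by exists 1 => //; rewrite scale1r mul1r.
have popp x : p (- x) = - p x.
  by apply/eqP; rewrite -addr_eq0 -padd addrC subrr sublinear0.
move=> a x y; rewrite padd; congr (_ + _).
have [a0|/ltW a0] := leP 0 a; first exact: sublinear_scale.
rewrite -[LHS]opprK -popp -scaleNr sublinear_scale ?oppr_ge0//.
by rewrite mulNr opprK.
Qed.

(** Mazur-Orlicz form of the Hahn-Banach theorem.  Demanding values on a cone,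
    and not only on a subspace, makes it a separation theorem as well. *)
Lemma hahn_banach_cone {q D} : sublinear q -> subcone D ->
    (forall c b, D c b -> b <= q c) ->
  exists L : {linear V -> R^o},
    (forall x, L x <= q x) /\ (forall c b, D c b -> b <= L c).
Proof.
move=> sq cD Dq; have [q' sq' hq'] := sublinear_descend sq cD Dq.
have [p [sp pq' pmin]] := exists_minimal_sublinear _ sq'.
have lp := minimal_sublinear_linear _ sp pmin.
pose L : {linear V -> R^o} := HB.pack (p : V -> R^o) (GRing.isLinear.Build _ _ _ _ _ lp).
exists L; split=> [x|c b Dcb].
  have [D0 _ _] := cD; apply: (le_trans (pq' x)).
  by rewrite (le_trans (hq' x _ _ D0))// addr0 subr0.
have : L (- c) <= - b.
  apply: (le_trans (pq' _)); apply: (le_trans (hq' _ _ _ Dcb)).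
  by rewrite addNr sublinear0// add0r.
by rewrite linearN lerN2.
Qed.

End hahn_banach.

(** * Functionals on finite families of vectors *)

Section duality.
Context {R : realType}.

(** Suprema may be taken one coordinate at a time because the coordinates of a
    family in the product of the [A i] vary independently. *)
Lemma sum_sup_le {I : finType} {A : I -> set R} {M : R} :
    (forall i, A i !=set0) ->
    (forall a : I -> R, (forall i, A i (a i)) -> \sum_i a i <= M) ->
  (forall i, has_ubound (A i)) /\ \sum_i sup (A i) <= M.
Proof.
move=> /choice[a0 Aa0] AM.
have Aub i : has_ubound (A i).
  exists (M - \sum_(j | j != i) a0 j) => x Ax; rewrite lerBrDr.
  have := AM (fun j => if j == i then x else a0 j).
  rewrite (bigD1 i)//= eqxx (eq_bigr a0) => [|j /negPf->//].
  by apply=> j; case: eqP => [->|].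
split=> //; apply/ler_addgt0Pr => e e0.
have n0 : 0 < #|I|%:R + 1 :> R by rewrite ltr_wpDl.
have /choice[a Ha] i : exists x, A i x /\ sup (A i) - e / (#|I|%:R + 1) < x.
  have := @sup_adherent R (A i) (e / (#|I|%:R + 1)).
  move=> [||x Ax hx]; [exact: divr_gt0|split=> //; by exists (a0 i)|by exists x].
apply: (@le_trans _ _ (\sum_i (a i + e / (#|I|%:R + 1)))).
  by apply: ler_sum => i _; rewrite -lerBlDr ltW// (Ha i).2.
rewrite big_split/=; apply: lerD; first by apply: AM => i; exact: (Ha i).1.
rewrite sumr_const -[leLHS]mulr_natr mulrAC -mulrA ler_piMr ?(ltW e0)//.
by rewrite ler_pdivrMr// mul1r lerDl.
Qed.

(** Convexity in homogeneous form, so that no division is needed in cones built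
    from convex sets; it includes [s = t = 0]. *)
Lemma convex_set_cone {V : lmodType R} {A : set V} {x y : V} {s t : R} :
    convex_set A -> A x -> A y -> 0 <= s -> 0 <= t ->
  exists2 z, A z & s *: x + t *: y = (s + t) *: z.
Proof.
move=> cA Ax Ay s0 t0.
have [st0|st0] := eqVneq (s + t) 0.
  exists x => //; move/eqP: st0; rewrite paddr_eq0// => /andP[/eqP-> /eqP->].
  by rewrite addr0 !scale0r addr0.
have stp : 0 < s + t by rewrite lt_neqAle eq_sym st0 addr_ge0.
have k0 : 0 <= s / (s + t) by rewrite divr_ge0// ltW.
have k1 : s / (s + t) <= 1 by rewrite ler_pdivrMr// mul1r lerDl.
have := cA x y (Itv01 k0 k1) (mem_set Ax) (mem_set Ay); rewrite inE => Az.
exists (s / (s + t) *: x + (1 - s / (s + t)) *: y); first exact: Az.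
rewrite scalerDr !scalerA mulrBr mulr1 [_ * (s / _)]mulrC divfK//.
by rewrite [s + t]addrC addrK.
Qed.

Context {X : normedModType R} {I : finType}.

Lemma family_norm_sublinear :
  sublinear (fun y : I -> X => \big[Num.max/0]_i `|y i|).
Proof.
split=> [x y|t x t0]; apply: bigmax_le => [|i _].
- by rewrite addr_ge0// bigmax_ge_id.
- by apply: (le_trans (ler_normD _ _)); rewrite lerD// le_bigmax.
- by rewrite mulr_ge0// bigmax_ge_id.
- by rewrite normrZ ger0_norm// ler_wpM2l// le_bigmax.
Qed.

(** The dual of a finite power of [X] with the sup norm is the power of the dual
    with the sum of the norms: testing [L] on families from the unit ball bounds
    that sum. *)
Lemma family_functional_components (L : {linear (I -> X) -> R^o}) :
    (forall y : I -> X, L y <= \big[Num.max/0]_i `|y i|) ->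
  exists2 f : I -> dual X, \sum_i `|f i| <= 1 &
    forall y : I -> X, L y = \sum_i f i (y i).
Proof.
move=> Lq.
pose single i (x : X) : I -> X := fun j => if j == i then x else 0.
pose f i (x : X) : R^o := L (single i x).
have fl i : linear (f i).
  move=> a x y; rewrite /f -linearP; congr (L _); apply/funext => j.
  by rewrite /single /= !fctE; case: eqP => // _; rewrite scaler0 addr0.
pose fL i : {linear X -> R^o} := HB.pack (f i) (GRing.isLinear.Build _ _ _ _ _ (fl i)).
have f_le i x : f i x <= `|x|.
  apply: (le_trans (Lq _)); apply: bigmax_le => // j _.
  by rewrite /single; case: eqP; rewrite ?normr0.
have f_norm i x : `|f i x| <= `|x|.
  rewrite ler_norml f_le lerNl andbT.
  by rewrite -[- f i x](linearN (fL i)) -[leRHS]normrN; exact: f_le.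
have f_cont i : continuous (f i).
  apply: (@bounded_linear_continuous _ _ _ (fL i)); apply/linear_boundedP.
  apply: filterS (nbhs_pinfty_ge (num_real 1)) => r r1 x.
  by apply: (le_trans (f_norm i x)); rewrite ler_peMl.
have fP i : is_functional (f i) by apply/asboolP; split.
have LE (y : I -> X) : L y = \sum_i f i (y i).
  rewrite [in LHS](_ : y = \sum_i single i (y i)) ?linear_sum//.
  apply/funext => j; rewrite fct_sumE (bigD1 j)//= big1 ?addr0.
    by rewrite /single eqxx.
  by move=> i; rewrite /single eq_sym => /negPf->.
exists (fun i => Dual (fP i)) => //.
apply: (sum_sup_le _ _).2 => [i|a fa].
  by exists `|f i 0|, 0 => //; rewrite /unit_ball/= normr0.
have /choice[y Hy] i : exists y : X, `|y| <= 1 /\ f i y = a i.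
  have [x x1 <-] := fa i; rewrite /=; have [_|_] := ger0P (f i x).
    by exists x.
  by exists (- x); rewrite normrN; split=> //; exact: (linearN (fL i)).
rewrite (eq_bigr (fun i => f i (y i))) => [|i _]; last by rewrite (Hy i).2.
rewrite -LE; apply: (le_trans (Lq _)); apply: bigmax_le => // i _.
exact: (Hy i).1.
Qed.

End duality.

(** * A dual certificate for a family without a common nearby point *)

Section certificate.
Context {R : realType} {X : normedModType R} {I : finType}.

Lemma dual_sumE (J : Type) (s : seq J) (f : J -> dual X) (x : X) :
  (\sum_(j <- s) f j) x = \sum_(j <- s) f j x.
Proof.
by elim/big_rec2: _ => // i y g _ <-.
Qed.

Lemma lower_bounded_functional_eq0 (f : dual X) (C : R) :
  (forall x, C <= f x) -> f = 0.
Proof.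
move=> fC; apply/val_inj/funext => x; apply/eqP/negPn/negP => fx0.
have := fC (((C - 1) / f x) *: x); rewrite linearZ/=.
have -> : (C - 1) / f x *: f x = C - 1 :> R by exact: divfK.
by rewrite -subr_ge0 addrC addKr oppr_ge0 ler10.
Qed.

(** In the power of [X] indexed by [I] with the sup norm, the families
    [fun i => x - z i] with [z i] in [K i] form a convex set of vectors of norm at
    least [r], and Hahn-Banach yields a functional of norm at most 1 that is at least [r]
    on this set.  Since [x] is arbitrary, its components [f i] sum to zero, and
    what remains bounds the sum of the suprema of the [f i] on the [K i] by
    [- r]. *)
Lemma far_convex_sets_certificate (K : I -> set X) (r : R) :
    0 < r -> (forall i, K i !=set0) -> (forall i, convex_set (K i)) ->
    (forall x, exists i, forall z, K i z -> r <= `|x - z|) ->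
  exists (f : I -> dual X) (h : I -> R),
    [/\ \sum_i f i = 0, \sum_i `|f i| = 1,
        forall i z, K i z -> f i z <= h i & \sum_i h i <= - r].
Proof.
move=> r0 K0 Kconv far.
have [z0 Kz0] := choice K0.
(* The cone over that convex set, with the demand [t * r] at height [t]. *)
pose D (c : I -> X) b := exists x z t,
  [/\ 0 <= t, forall i, K i (z i), forall i, c i = x - t *: z i & b = t * r].
have cD : subcone D.
  split.
  - by exists 0, z0, 0; split=> // [i|]; rewrite ?mul0r// scale0r subr0.
  - move=> c b c' b' [x [z [t [t0 Kz cE ->]]]] [x' [z' [t' [t'0 Kz' cE' ->]]]].
    have /choice[w Hw] i : exists w, K i w /\ t *: z i + t' *: z' i = (t + t') *: w.
      have [w Kw wE] := convex_set_cone (Kconv i) (Kz i) (Kz' i) t0 t'0.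
      by exists w.
    exists (x + x'), w, (t + t'); split=> [|i|i|].
    - exact: addr_ge0.
    - exact: (Hw i).1.
    - by rewrite -(Hw i).2 -[LHS]/(c i + c' i) cE cE' opprD addrACA.
    - by rewrite mulrDl.
  - move=> s c b s0 [x [z [t [t0 Kz cE ->]]]].
    exists (s *: x), z, (s * t); split=> // [|i|]; first exact: mulr_ge0.
      by rewrite -[LHS]/(s *: c i) cE scalerBr scalerA.
    by rewrite mulrA.
have Dq c b : D c b -> b <= \big[Num.max/0]_i `|c i|.
  move=> [x [z [t [t0 Kz cE ->]]]].
  have [->|tn0] := eqVneq t 0; first by rewrite mul0r bigmax_ge_id.
  have [i /(_ _ (Kz i)) ri] := far (t^-1 *: x).
  apply: (le_trans _ (le_bigmax _ _ i)).
  rewrite cE -[x in x - _](scalerKV tn0) -scalerBr normrZ ger0_norm//.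
  exact: ler_wpM2l.
have [L [Lq LD]] := hahn_banach_cone family_norm_sublinear cD Dq.
have [f f1 LE] := family_functional_components L Lq.
have sep x (z : I -> X) : (forall i, K i (z i)) ->
    r <= (\sum_i f i) x - \sum_i f i (z i).
  move=> Kz; have : r <= L (fun i => x - z i).
    by apply: LD; exists x, z, 1; rewrite mul1r; split=> // i; rewrite scale1r.
  rewrite LE dual_sumE -sumrB => /le_trans; apply.
  by apply: ler_sum => i _; rewrite linearB.
have f0 : \sum_i f i = 0.
  apply: (@lower_bounded_functional_eq0 _ (r + \sum_i f i (z0 i))) => x.
  by rewrite -lerBrDr sep.
have sep0 z : (forall i, K i (z i)) -> \sum_i f i (z i) <= - r.
  by move=> /(sep 0); rewrite f0 lerNr sub0r.
pose A i := [set (f i z : R) | z in K i].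
have A0 i : A i !=set0 by exists (f i (z0 i)), (z0 i).
have [Aub Asup] : (forall i, has_ubound (A i)) /\ \sum_i sup (A i) <= - r.
  apply: sum_sup_le => // a Aa.
  have /choice[z Hz] i : exists z, K i z /\ a i = f i z by have [z] := Aa i; exists z.
  by rewrite (eq_bigr (fun i => f i (z i))) ?sep0// => i; have [] := Hz i.
have s0 : 0 < \sum_i `|f i|.
  rewrite lt_neqAle sumr_ge0// andbT eq_sym; apply/eqP => s0.
  have fE i : f i = 0 by apply/normr0_eq0; apply: (psumr_eq0P _ s0).
  have := sep0 _ Kz0; rewrite big1 => [|i _]; last by rewrite fE.
  by rewrite oppr_ge0 leNgt r0.
(* Dividing by [s <= 1] normalizes the norms and only lowers the bound [- r]. *)
set s := \sum_i _ in s0 f1.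
exists (fun i => s^-1 *: f i), (fun i => s^-1 * sup (A i)); split.
- by rewrite -scaler_sumr f0 scaler0.
- under eq_bigr do rewrite normrZ ger0_norm ?invr_ge0 ?(ltW s0)//.
  by rewrite -mulr_sumr mulVf// gt_eqF.
- move=> i z Kz; rewrite -[leLHS]/(s^-1 * f i z) ler_wpM2l ?invr_ge0 ?(ltW s0)//.
  by apply: ub_le_sup => //; exists z.
- rewrite -mulr_sumr ler_pdivrMl// (le_trans Asup)// mulrN lerN2.
  by rewrite ler_piMl// ltW.
Qed.

End certificate.

(** * Independent samples and symmetrization *)

Section iid_mean.
Context {R : realType} {I : finType} {w : I -> R}.
Hypotheses (w_ge0 : forall i, 0 <= w i) (w_sum1 : \sum_i w i = 1).

(** The expectation of [F] at a sequence of [k] independent indices of law [w];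
    the recursion conditions on the first draw. *)
Fixpoint iid_mean k (F : seq I -> R) : R :=
  if k is k'.+1 then \sum_i w i * iid_mean k' (fun s => F (i :: s))
  else F [::].

(** Only samples from the support of [w] matter. *)
Lemma le_iid_mean {k} {F G : seq I -> R} :
  (forall s, size s = k -> all (fun i => w i != 0) s -> F s <= G s) ->
  iid_mean k F <= iid_mean k G.
Proof.
elim: k F G => [|k IH] F G FG /=; first exact: FG.
apply: ler_sum => i _; have [->|wi] := eqVneq (w i) 0; first by rewrite !mul0r.
rewrite ler_wpM2l//; apply: IH => s sk sw; apply: FG => /=; first by rewrite sk.
by rewrite wi.
Qed.

Lemma eq_iid_mean {k} {F G : seq I -> R} :
  (forall s, size s = k -> F s = G s) -> iid_mean k F = iid_mean k G.
Proof.
by move=> FG; apply/eqP; rewrite eq_le !le_iid_mean// => s /FG->.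
Qed.

Lemma iid_meanZ k a F : iid_mean k (fun s => a * F s) = a * iid_mean k F.
Proof.
elim: k F => //= k IH F; rewrite mulr_sumr.
by apply: eq_bigr => i _; rewrite IH mulrCA.
Qed.

Lemma iid_meanD k F G :
  iid_mean k (fun s => F s + G s) = iid_mean k F + iid_mean k G.
Proof.
elim: k F G => //= k IH F G; rewrite -big_split.
by apply: eq_bigr => i _; rewrite IH mulrDr.
Qed.

Lemma iid_mean_cst k a : iid_mean k (fun=> a) = a.
Proof.
by elim: k => //= k ->; rewrite -mulr_suml w_sum1 mul1r.
Qed.

Lemma iid_mean_sum k (J : Type) (r : seq J) (F : J -> seq I -> R) :
  iid_mean k (fun s => \sum_(j <- r) F j s) = \sum_(j <- r) iid_mean k (F j).
Proof.
elim: r => [|j r IH].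
  by rewrite big_nil -[RHS](iid_mean_cst k); apply: eq_iid_mean => s _; rewrite big_nil.
rewrite big_cons -IH -iid_meanD; apply: eq_iid_mean => s _; exact: big_cons.
Qed.

Lemma iid_mean_sample_sum k (h : I -> R) :
  iid_mean k (fun s => \sum_(i <- s) h i) = k%:R * \sum_i w i * h i.
Proof.
elim: k => [|k IH] /=; first by rewrite big_nil mul0r.
rewrite (eq_bigr (fun i => w i * h i + w i * (k%:R * \sum_j w j * h j))).
  by rewrite big_split -mulr_suml w_sum1 mul1r/= -nat1r mulrDl mul1r.
move=> i _; rewrite -mulrDr -IH -[h i in RHS](iid_mean_cst k) -iid_meanD.
by congr (_ * _); apply: eq_iid_mean => s _; rewrite big_cons.
Qed.

Section symmetrization.
Context {Y : normedModType R} {g : I -> Y}.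
Hypothesis g_mean0 : \sum_i w i *: g i = 0.

(** The labels [b] choose the coefficients through [phi]; several coefficient
    functions are compared for the same labels. *)
Definition signed_sum (phi : bool -> R) (b : seq bool) (s : seq I) : Y :=
  \sum_(x <- zip b s) phi x.1 *: g x.2.

Let mean_norm phi b u := iid_mean (size b) (fun s => `|u + signed_sum phi b s|).

Lemma mean_norm_cons phi a b u :
  mean_norm phi (a :: b) u = \sum_i w i * mean_norm phi b (u + phi a *: g i).
Proof.
apply: eq_bigr => i _; congr (_ * _); apply: eq_iid_mean => s _.
by rewrite /signed_sum /= big_cons addrA.
Qed.

Lemma mean_norm_convex phi b (u : I -> Y) :
  mean_norm phi b (\sum_i w i *: u i) <= \sum_i w i * mean_norm phi b (u i).
Proof.
rewrite /mean_norm; under [leRHS]eq_bigr do rewrite -iid_meanZ.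
rewrite -iid_mean_sum; apply: le_iid_mean => s _ _.
have -> : \sum_i w i *: u i + signed_sum phi b s =
    \sum_i w i *: (u i + signed_sum phi b s).
  under [RHS]eq_bigr do rewrite scalerDr.
  by rewrite big_split -scaler_suml w_sum1 scale1r.
apply: (le_trans (ler_norm_sum _ _ _)); apply: ler_sum => i _.
by rewrite normrZ ger0_norm.
Qed.

(** Dropping some terms cannot increase the mean norm: by Jensen's inequality,
    replacing an independent term by its mean, which is zero, lowers it. *)
Lemma mean_norm_zeroing phi psi b u :
    (forall a, phi a = 0 \/ phi a = psi a) ->
  mean_norm phi b u <= mean_norm psi b u.
Proof.
move=> phi_psi; elim: b u => [|a b IH] u.
  by rewrite /mean_norm /= /signed_sum !big_nil.
rewrite !mean_norm_cons; have [->|->] := phi_psi a; last first.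
  by apply: ler_sum => i _; rewrite ler_wpM2l.
apply: (@le_trans _ _ (mean_norm psi b u)).
  rewrite -[leRHS]mul1r -w_sum1 mulr_suml; apply: ler_sum => i _.
  by rewrite scale0r addr0 ler_wpM2l.
have {1}-> : u = \sum_i w i *: (u + psi a *: g i).
  under eq_bigr do rewrite scalerDr scalerA mulrC -scalerA.
  by rewrite big_split -scaler_suml w_sum1 scale1r/= -scaler_sumr g_mean0 scaler0 addr0.
exact: mean_norm_convex.
Qed.

(** Symmetrization for a fixed pattern of signs: the plain sum is the difference
    between the plus part and the minus part of the signed sum, and each part is the
    signed sum with some terms dropped. *)
Lemma iid_mean_norm_le_signed b :
  iid_mean (size b) (fun s => `|\sum_(i <- s) g i|) <=
  2 * iid_mean (size b) (fun s => `|signed_sum (fun a => (-1) ^+ a) b s|).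
Proof.
have E phi : iid_mean (size b) (fun s => `|signed_sum phi b s|) = mean_norm phi b 0.
  by apply: eq_iid_mean => s _; rewrite add0r.
rewrite E mulr2n mulrDl mul1r.
apply: (@le_trans _ _ (mean_norm (fun a => (~~ a)%:R) b 0 +
                       mean_norm (fun a => - a%:R) b 0)).
  rewrite -!E -iid_meanD; apply: le_iid_mean => s sb _.
  apply: le_trans (ler_normB _ _); rewrite /signed_sum -sumrB.
  rewrite (eq_bigr (fun x => g x.2)) => [|[[] i] _]; rewrite /= ?scale1r.
  - by rewrite -(big_map snd predT g) -/(unzip2 _) unzip2_zip// sb.
  - by rewrite scale0r sub0r scaleN1r opprK.
  - by rewrite oppr0 scale0r subr0.
by rewrite lerD// mean_norm_zeroing// => -[]; rewrite /= ?oppr0 ?expr0 ?expr1; auto.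
Qed.

(** The bound for fixed signs holds for every pattern, hence for their average,
    and the average over signs moves inside the mean over samples. *)
Lemma iid_mean_norm_le_rademacher k B (i0 : I) :
    (forall s, size s = k -> all (fun i => w i != 0) s ->
      (2 ^+ k)^-1 * \sum_(e : {ffun 'I_k -> bool})
        `|\sum_(j < k) (-1) ^+ e j *: g (nth i0 s j)| <= B) ->
  iid_mean k (fun s => `|\sum_(i <- s) g i|) <= 2 * B.
Proof.
move=> Bs; pose b (e : {ffun 'I_k -> bool}) := [seq e j | j <- enum 'I_k].
have size_b e : size (b e) = k by rewrite size_map size_enum_ord.
have bE e s : size s = k -> signed_sum (fun a => (-1) ^+ a) (b e) s =
    \sum_(j < k) (-1) ^+ e j *: g (nth i0 s j).
  move=> sk; rewrite /signed_sum (big_nth (false, i0)) size_zip size_b sk minnn.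
  rewrite big_mkord; apply: eq_bigr => j _; rewrite nth_zip ?size_b//=.
  by rewrite (nth_map j) ?size_enum_ord// nth_ord_enum.
set m := iid_mean k _.
have me (e : {ffun 'I_k -> bool}) :
    m <= 2 * iid_mean k (fun s => `|\sum_(j < k) (-1) ^+ e j *: g (nth i0 s j)|).
  have := iid_mean_norm_le_signed (b e); rewrite size_b => /le_trans; apply.
  by rewrite ler_pM2l//; apply: le_iid_mean => s sk _; rewrite bE.
have c0 : (0 : R) < 2 ^+ k by rewrite exprn_gt0.
have -> : m = (2 ^+ k)^-1 * \sum_(e : {ffun 'I_k -> bool}) m.
  rewrite sumr_const card_ffun card_bool card_ord -[m *+ _]mulr_natl natrX.
  by rewrite mulKf// gt_eqF.
apply: (@le_trans _ _ (2 * iid_mean k (fun s => (2 ^+ k)^-1 *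
    \sum_(e : {ffun 'I_k -> bool}) `|\sum_(j < k) (-1) ^+ e j *: g (nth i0 s j)|))).
  rewrite iid_meanZ iid_mean_sum mulrCA ler_pM2l ?invr_gt0//.
  by rewrite mulr_sumr; apply: ler_sum => e _.
rewrite ler_pM2l// -[leRHS](iid_mean_cst k); exact: le_iid_mean.
Qed.

End symmetrization.
End iid_mean.
Arguments iid_mean {R I} w k F.

(** * Rademacher type for families with repetitions *)

Section rademacher_sums.
Context {R : realType} {Y : completeNormedModType R}.

Lemma average_sign_norm_image {J : finType} {y : J -> Y} : injective y ->
  average_sign_norm [fset y j | j in J]%fset =
  (2 ^+ #|J|)^-1 * \sum_(e : {ffun J -> bool}) `|\sum_j (-1) ^+ e j *: y j|.
Proof.
move=> yI; set S := [fset y j | j in J]%fset.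
have cardS : #|` S| = #|J| by rewrite card_imfset//= cardE.
have yS j : y j \in S by apply/imfsetP; exists j.
pose phi j : S := [` yS j]%fset.
have phiI : injective phi by move=> i j /(congr1 val) /yI.
have phi_bij : bijective phi by apply: inj_card_bij => //; rewrite -cardfE cardS.
have [psi phiK psiK] := phi_bij.
rewrite /average_sign_norm cardS; congr (_ * _).
pose h (e : {ffun J -> bool}) : {ffun S -> bool} := [ffun s => e (psi s)].
rewrite (reindex h)/=; last first.
  apply: onW_bij; exists (fun e : {ffun S -> bool} => [ffun j => e (phi j)]) => e.
    by apply/ffunP => j; rewrite !ffunE phiK.
  by apply/ffunP => j; rewrite !ffunE psiK.
apply: eq_bigr => e _; rewrite (reindex phi)/=; last exact: onW_bij.
by congr (`|_|); apply: eq_bigr => j _; rewrite ffunE phiK.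
Qed.

Lemma sum_fset_image {J : finType} {y : J -> Y} (F : Y -> R) : injective y ->
  \sum_(s : [fset y j | j in J]%fset) F (val s) = \sum_j F (y j).
Proof.
move=> yI; rewrite -(big_seq_fsetE _ _ predT F) big_imfset//=; last by move=> i j _ _ /yI.
by rewrite big_enum.
Qed.

(** Type is defined through sets of vectors, but a sample may repeat a vector.
    Shrinking the [j]-th unit vector by the factor [1 - j / k ^ 2] makes the norms,
    hence the vectors, pairwise distinct, and changes a signed sum by at most 1. *)
Lemma type_unit_vectors (p T : R) k (v : 'I_k -> Y) :
    0 < p -> is_type_constant Y p T -> (forall j, `|v j| = 1) ->
  (2 ^+ k)^-1 * \sum_(e : {ffun 'I_k -> bool}) `|\sum_j (-1) ^+ e j *: v j|
    <= T * k%:R `^ p^-1 + 1.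
Proof.
move=> p0 [T0 HT] v1.
pose d (j : 'I_k) : R := j%:R / k%:R ^+ 2.
have d0 j : 0 <= d j by rewrite divr_ge0// exprn_ge0.
have d_le j : d j <= k%:R^-1.
  have k0 : 0 < k%:R :> R by rewrite ltr0n (leq_ltn_trans _ (ltn_ord j)).
  rewrite /d ler_pdivrMr ?exprn_gt0// expr2 mulrA mulVf ?gt_eqF// mul1r.
  by rewrite ler_nat ltnW.
have d1 j : d j < 1.
  have k0 : 0 < k%:R :> R by rewrite ltr0n (leq_ltn_trans _ (ltn_ord j)).
  rewrite /d ltr_pdivrMr ?exprn_gt0// mul1r -natrX ltr_nat.
  rewrite (leq_trans (ltn_ord j))// expnS expn1 leq_pmulr//.
  exact: leq_ltn_trans (ltn_ord j).
pose y j := (1 - d j) *: v j.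
have yn j : `|y j| = 1 - d j.
  by rewrite normrZ v1 mulr1 ger0_norm// subr_ge0 ltW.
have yI : injective y.
  move=> i j /(congr1 Num.norm); rewrite !yn => /addrI/oppr_inj/mulIf E.
  apply/val_inj/eqP; rewrite -(eqr_nat R); apply/eqP/E.
  have k0 : 0 < k%:R :> R by rewrite ltr0n (leq_ltn_trans _ (ltn_ord j)).
  by rewrite gt_eqF// invr_gt0 exprn_gt0.
have := HT [fset y j | j in 'I_k]%fset.
rewrite average_sign_norm_image// (sum_fset_image (fun x => `|x| `^ p))// card_ord => Hy.
have Sp : \sum_j `|y j| `^ p <= k%:R.
  rewrite -[k in leRHS]card_ord -sumr_const; apply: ler_sum => j _.
  have <- : 1 `^ p = 1 :> R by rewrite powR1.
  rewrite yn; apply: ge0_ler_powR; rewrite ?nnegrE ?subr_ge0 ?(ltW p0) ?(ltW (d1 j))//.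
  by rewrite gerBl.
apply: (@le_trans _ _ ((2 ^+ k)^-1 *
  \sum_(e : {ffun 'I_k -> bool}) (`|\sum_j (-1) ^+ e j *: y j| + 1))).
  rewrite ler_pM2l ?invr_gt0 ?exprn_gt0//; apply: ler_sum => e _.
  rewrite -lerBlDl; apply: (le_trans (lerB_dist _ _)); rewrite -sumrB.
  apply: (le_trans (ler_norm_sum _ _ _)).
  apply: (@le_trans _ _ (\sum_(j < k) k%:R^-1)).
    apply: ler_sum => j _; rewrite -scalerBr normrZ normr_sign mul1r.
    rewrite /y scalerBl scale1r opprB addrC subrK normrZ v1 mulr1 ger0_norm//.
  rewrite sumr_const card_ord -[leLHS]mulr_natl.
  have [->|k0] := eqVneq k 0; first by rewrite mul0r.
  by rewrite divff// pnatr_eq0.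
rewrite big_split/= mulrDr lerD//.
  apply: (le_trans Hy); rewrite ler_wpM2l//; apply: ge0_ler_powR => //.
  - by rewrite invr_ge0 ltW.
  - by rewrite nnegrE sumr_ge0// => j _; exact: powR_ge0.
  - by rewrite nnegrE.
by rewrite sumr_const card_ffun card_bool card_ord natrX mulVf.
Qed.

(** A single nonzero vector has average sign norm equal to its norm. *)
Lemma type_constant_ge1 (p T : R) (y : Y) :
  0 < p -> y != 0 -> is_type_constant Y p T -> 1 <= T.
Proof.
move=> p0 y0 [_ HT].
have yI : injective (fun _ : 'I_1 => y) by move=> i j _; rewrite !ord1.
have := HT [fset y | j in 'I_1]%fset.
rewrite average_sign_norm_image// (sum_fset_image (fun x => `|x| `^ p))//.
rewrite big_ord1 -powRrM mulfV ?gt_eqF// powRr1// card_ord expr1.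
under eq_bigr do rewrite big_ord1 normrZ normr_sign mul1r.
rewrite sumr_const card_ffun card_bool card_ord -[ `|y| *+ _]mulr_natl.
rewrite mulrA expn1 mulVf ?pnatr_eq0//.
by rewrite ler_pM2r ?normr_gt0.
Qed.

(** The infimum defining the type constant is attained, since each inequality that
    it must satisfy is closed in [T]. *)
Lemma type_constantP (p : R) : rademacher_type Y p ->
  is_type_constant Y p (type_constant Y p).
Proof.
move=> [_ [T0 HT0]]; pose A := [set T | is_type_constant Y p T].
have A0 : A !=set0 by exists T0.
split; first by apply: lb_le_inf => // T [].
move=> S; set B := _ `^ _.
have : 0 <= B by exact: powR_ge0.
rewrite le_eqVlt => /predU1P[B0|B0].
  by have := HT0.2 S; rewrite -/B -B0 !mulr0.
rewrite -ler_pdivrMr//; apply: lb_le_inf => // T [_ HT].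
by rewrite ler_pdivrMr//; exact: HT.
Qed.

End rademacher_sums.

(** * The approximate Helly theorem *)

Section helly_bound.
Context {R : realType} {X : completeNormedModType R}.

(** No point is close to both [0] and [x]; apply the certificate to the two
    singletons. *)
Lemma exists_nonzero_functional (x : X) : x != 0 -> exists f : dual X, f != 0.
Proof.
move=> x0; have r0 : 0 < `|x| / 2 by rewrite divr_gt0// normr_gt0.
have [|||f [h [_ f1 _ _]]] := @far_convex_sets_certificate R X bool
    (fun b => [set if b then x else 0]) (`|x| / 2) r0.
- by move=> b; eexists; reflexivity.
- by move=> b y z k /set_mem-> /set_mem->; rewrite convmm inE.
- move=> y; have [yr|yr] := leP (`|x| / 2) `|y|.
    by exists false => _ ->; rewrite subr0.
  exists true => _ ->; rewrite distrC; apply: le_trans (lerB_dist _ _).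
  by rewrite lerBrDr [leRHS](splitr `|x|) lerD2l ltW.
- apply/not_existsP => f0; move: f1; rewrite big1 => [/esym/eqP|b _].
    by rewrite oner_eq0.
  by apply/eqP; rewrite normr_eq0; apply/negPn/negP; exact: f0.
Qed.

(** Draw [k] indices with probabilities [`|f i|] for the certificate [f], [h].  The
    normalized functionals [g i] have mean zero, so their sum has small mean norm.
    At a common point of the drawn sets in the unit ball that sum is at most
    the sum of the normalized bounds [h i], whose mean is at most [- k r]. *)
Lemma far_family_radius_le {I : finType} {K : I -> set X} {r p T : R} {k : nat} :
    0 < p -> is_type_constant (dual X) p T -> 0 < r ->
    (forall i, K i !=set0) -> (forall i, convex_set (K i)) ->
    (forall s : 'I_k -> I,
      unit_ball X `&` \bigcap_(j in [set: 'I_k]) K (s j) !=set0) ->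
    (forall x, exists i, forall z, K i z -> r <= `|x - z|) ->
  k%:R * r <= 2 * (T * k%:R `^ p^-1 + 1).
Proof.
move=> p0 HT r0 K0 Kconv Kk far.
have [i0 _] := far 0.
have [f [h [f0 f1 fh hr]]] := far_convex_sets_certificate K r r0 K0 Kconv far.
pose w i := `|f i|; pose g i := (w i)^-1 *: f i.
have w0 i : 0 <= w i by exact: normr_ge0.
have wg i : w i *: g i = f i.
  rewrite /g scalerA; have [wi|wi] := eqVneq (w i) 0; last by rewrite divff// scale1r.
  by rewrite wi mul0r scale0r (normr0_eq0 wi).
have g0 : \sum_i w i *: g i = 0 by under eq_bigr do rewrite wg.
(* Drawn indices lie in the support of [w], where [g] takes unit vectors. *)
have gn : iid_mean w k (fun s => `|\sum_(i <- s) g i|) <= 2 * (T * k%:R `^ p^-1 + 1).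
  apply: (iid_mean_norm_le_rademacher w0 f1 g0 _ _ i0) => s sk sw.
  apply: type_unit_vectors => // j.
  have wj : w (nth i0 s j) != 0 by apply: (all_nthP i0 sw); rewrite sk.
  by rewrite normrZ normfV normr_id mulVf.
(* Terms of weight zero contribute nothing on the left, and on the right a bound
   of the zero functional on a nonempty set. *)
have wh : \sum_i w i * (h i / w i) <= - r.
  apply: le_trans hr; apply: ler_sum => i _.
  have [wi|wi] := eqVneq (w i) 0; last by rewrite mulrC divfK.
  have [z Kz] := K0 i; rewrite wi mul0r; apply: le_trans (fh i z Kz).
  by rewrite (normr0_eq0 wi).
apply: le_trans gn; rewrite -lerN2 -mulrN.
apply: (@le_trans _ _ (k%:R * \sum_i w i * (h i / w i))); last first.
  by rewrite ler_wpM2l.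
rewrite -(iid_mean_sample_sum w0 f1) -mulN1r -iid_meanZ.
apply: (le_iid_mean w0) => s sk _; rewrite mulN1r.
have [x [x1 Kx]] := Kk (fun j => nth i0 s j).
have Ksx i : i \in s -> K i x.
  move=> si; have si' : (index i s < k)%N by rewrite -sk index_mem.
  by have := Kx (Ordinal si') Logic.I; rewrite /= nth_index.
apply: (@le_trans _ _ ((\sum_(i <- s) g i) x)).
  have : `|(\sum_(i <- s) g i) x| <= `|\sum_(i <- s) g i|.
    by apply: (le_trans (dual_le _ _)); apply: ler_piMr => //; exact: opnorm_ge0.
  by rewrite ler_norml => /andP[].
rewrite dual_sumE big_seq [leRHS]big_seq; apply: ler_sum => i /Ksx Kix.
by rewrite mulrC -[leLHS]/((w i)^-1 * f i x) ler_wpM2l ?invr_ge0// fh.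
Qed.

Lemma type_helly {p T : R} {k : nat} {F : set (set X)} :
    0 < p -> is_type_constant (dual X) p T -> (1 <= k)%N ->
    finite_set F -> (forall K, F K -> convex_set K) -> meets_in_ball k F ->
  exists x : X, forall K, F K ->
    (dist x K <= (6 * T * k%:R `^ (-1 + p^-1))%:E)%E.
Proof.
move=> p0 HT k1 finF Fconv Fk.
set r := _ * _.
have r0 : 0 <= r by rewrite mulr_ge0 ?powR_ge0// mulr_ge0// HT.1.
have F0 K : F K -> K !=set0.
  move=> FK; have [x [_ Kx]] := Fk (fun=> K) (fun=> FK).
  by exists x; exact: (Kx (Ordinal k1)).
(* In the zero space [T] may vanish, and so may [r]. *)
have [X0|/existsNP[y /eqP y0]] := pselect (forall x : X, x = 0).
  exists 0 => K FK; have [z Kz] := F0 K FK.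
  apply: ereal_inf_le; exists `|0 - z|%:E; first by exists z.
  by rewrite (X0 z) subrr normr0 lee_fin.
have [f fn0] := exists_nonzero_functional _ y0.
have T1 := type_constant_ge1 p T f p0 fn0 HT.
have Tk : 1 <= T * k%:R `^ p^-1.
  rewrite -[leLHS]mulr1; apply: ler_pM => //.
  by rewrite -[leLHS](powRr0 k%:R) ler_powR ?ler1n// invr_ge0 ltW.
have kr : k%:R * r = 6 * (T * k%:R `^ p^-1).
  by rewrite /r mulrCA addrC mulr_powRB1 ?invr_gt0// mulrA.
have k0 : 0 < k%:R :> R by rewrite ltr0n.
have rp : 0 < r by rewrite -(pmulr_rgt0 _ k0) kr mulr_gt0// (lt_le_trans _ Tk).
apply/not_existsP => far.
have [s Fs] := (finite_seqP F).1 finF.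
pose K (i : 'I_(size s)) := nth set0 s i.
have FK i : F (K i) by rewrite Fs /=; exact: mem_nth.
have Kfar x : exists i, forall z, K i z -> r <= `|x - z|.
  have /existsNP[A /not_implyP[FA /negP]] := far x.
  rewrite -ltNge => rA.
  have As : A \in s by move: FA; rewrite Fs.
  have As' := As; rewrite -index_mem in As'.
  exists (Ordinal As') => z; rewrite /K /= nth_index// => Az.
  by rewrite -lee_fin (le_trans (ltW rA))//; apply: ereal_inf_lbound; exists z.
have := far_family_radius_le p0 HT rp (fun i => F0 _ (FK i))
  (fun i => Fconv _ (FK i)) (fun t => Fk _ (fun j => FK (t j))) Kfar.
(* Compare [k r = 6 t] with [2 (t + 1) <= 4 t], where [t >= 1]. *)
rewrite kr leNgt => /negP; apply.
set t := T * _ in Tk *.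
by lra.
Qed.

Lemma cvg_powR_natr_neg (a : R) : a < 0 -> (fun k : nat => k%:R `^ a) @ \oo --> (0 : R).
Proof.
move=> a0; apply/cvgrPdist_lt => e e0.
near=> k.
have k0 : 0 < k%:R :> R by rewrite ltr0n; near: k; exact: nbhs_infty_gt.
rewrite sub0r normrN ger0_norm ?powR_ge0// -[a]opprK powRN.
rewrite -[e]invrK ltf_pV2 ?posrE ?invr_gt0 ?powR_gt0//.
have -> : e^-1 = (e^-1 `^ (- a)^-1) `^ (- a).
  by rewrite -powRrM mulVf ?powRr1 ?invr_ge0 ?ltW// oppr_eq0 lt_eqF.
rewrite gt0_ltr_powR ?nnegrE ?oppr_gt0 ?powR_ge0 ?ltW//.
near: k; exact: nbhs_infty_gtr.
Unshelve. all: by end_near. Qed.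

End helly_bound.

Theorem theorem1p1 (R : realType) (X : completeNormedModType R) :
  (forall p : R, 1 < p <= 2 -> rademacher_type (dual X) p ->
   forall k : nat, (1 <= k)%N ->
   forall F : set (set X), finite_set F ->
     (forall K, F K -> convex_set K) ->
     meets_in_ball k F ->
   exists x : X, forall K, F K ->
     (dist x K <= (6 * type_constant (dual X) p * k%:R `^ (-1 + p^-1))%:E)%E)
  /\ (nontrivial_type (dual X) -> helly_approximation_property X).
Proof.
have bound (p : R) : 1 < p -> rademacher_type (dual X) p ->
    forall k : nat, (1 <= k)%N ->
    forall F : set (set X), finite_set F ->
      (forall K, F K -> convex_set K) -> meets_in_ball k F ->
    exists x : X, forall K, F K ->
      (dist x K <= (6 * type_constant (dual X) p * k%:R `^ (-1 + p^-1))%:E)%E.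
  move=> p1 typ k k1 F; apply: (type_helly _ (type_constantP p typ)) => //.
  exact: lt_trans p1.
split=> [p /andP[p1 _]|[p p1 typ]]; first exact: bound.
exists (fun k => 6 * type_constant (dual X) p * k%:R `^ (-1 + p^-1)).
  move=> k k1 F finF convF Fk.
  by have [x xF] := bound p p1 typ k k1 F finF convF Fk; exists x.
rewrite -[X in _ --> X](mulr0 (6 * type_constant (dual X) p)).
apply: cvgMr; apply: cvg_powR_natr_neg.
by rewrite addrC subr_lt0 invf_lt1// (lt_trans _ p1).
Qed.
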